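(* Consider the procedure ''Boosting Using SDP'' with inputs $\hat A\in\mathbb R^{n\times n}$, parameters $0<\zeta<1$, $d>0$, $K\ge10^4$, and an initial labelling $\ell_{\mathrm{init}}\in\{-1,1\}^n$: set $\ell\leftarrow\ell_{\mathrm{init}}$; then $\lceil10\log n\rceil$ times, compute an optimal solution of the Boosting SDP with inputs $\hat A,\ell,\zeta,d,K$, flip the sign of $\ell_i$ for every $i$ with $w_i\ge1-1/\sqrt K$, and replace $\ell$ by the result; output $\ell$. Suppose there are a subset $S\subseteq[n]$ with $|S|\ge(1-\gamma)n$ where $\gamma\le0.1\zeta$, an $n\times n$ matrix $F$, and a labelling $\tilde\ell\in\{-1,1\}^n$ with $\tilde L=\tilde\ell\tilde\ell^T$ such that: (1) $\ell_{\mathrm{init}}$ agrees with $\tilde\ell$ on at least $(1-0.1\zeta)n$ coordinates; (2) $(F\odot\tilde L)_{S\times S}$ is entrywise nonnegative; (3) $(\hat A-F)_{S\times S}=Y+Z$ with $\|Y\|_{\mathrm{op}}\le Kd$ and $|Z_{ij}|\le Kd/(\zeta n)$ for all $i,j$; (4) for every $T\subseteq S$ with $|T|\ge(1-\zeta)n$, the matrix $((\hat A-F)\odot\tilde L)_{T\times T}$ is resolvable with parameters $\big(10dK^3,\ 0.5dK(\gamma+\frac{n-|T|}{n})\big)$. Then the output agrees with $\tilde\ell$ on at least $(1-8\gamma)n$ coordinates.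
   Context: Notation: $J$ all-ones matrix, $\odot$ entrywise product, $\langle X,Y\rangle=\sum_{ij}X_{ij}Y_{ij}$, $\|\cdot\|_1$ trace norm, $\|\cdot\|_{\mathrm{op}}$ operator norm, $M_{S\times T}$ submatrix indexed by $S\times T$. Resolvability: an $m\times m$ matrix $X$ is $(d_1,d_2)$-resolvable if for all $x_1,\dots,x_m\in[0,1]$ with $\sum_ix_i\le10^{-6}m$, $\langle X,Y_x\rangle\ge d_1\sum_ix_i-d_2m$, where $(Y_x)_{ij}=x_i$. Pseudorectangles: $\mathcal R_n(\theta)$ is the set of $n\times n$ matrices $M$ with $0\le M_{ij}\le1$, $\sum_{ij}|M_{ij}|\le\theta^2n^2$, $\|M\|_1\le\theta n$. Approximate row selectors: $(M,x_1,\dots,x_n)\in\mathcal S_n(\theta,\delta)$ if $0\le M_{ij}\le1$, $0\le x_i\le1$, $\sum_ix_i\le\theta n$, and $M=Y_x-N$ for some $N\in\mathcal R_n(\sqrt{\theta\delta})$. Boosting SDP (inputs $\hat A,\ell$, parameters $\zeta,d,K$ with $0<\zeta<1$, $K\ge10^4$): variables $\rho\in[0,\zeta]$, $w\in\mathbb R^n$, $W\in\mathbb R^{n\times n}$, $N\in\mathcal R_n(\rho)$ with $0\le w_i\le1$, $\sum_iw_i\le\rho n$, $W_{ij}\ge0$, $W_{ij}=1-w_i-w_j+N_{ij}$ for all $i,j$, and for every $\rho'$ with $\rho/K\le\rho'\le\zeta$ and every $(M,x)\in\mathcal S_n(\rho',K\rho')$: $\langle\hat A\odot L\odot W,M\rangle\ge10dK^2\big(K\sum_ix_i(1-w_i)-\rho'n\big)$,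 where $L=\ell\ell^T$. Objective: minimize $\rho$. *)

(* Defs.v *)
From HB Require Import structures.
From mathcomp Require Import all_boot all_order all_algebra.
From mathcomp Require Import all_classical all_reals exp.
Set Implicit Arguments. Unset Strict Implicit. Unset Printing Implicit Defensive.
Import Order.TTheory GRing.Theory Num.Theory.
Local Open Scope ring_scope.

Section Defs.
Variable R : realType.

Definition hadamard m n (A B : 'M[R]_(m, n)) : 'M[R]_(m, n) :=
  \matrix_(i, j) (A i j * B i j).

Definition frob m n (X Y : 'M[R]_(m, n)) : R := \sum_i \sum_j X i j * Y i j.

Definition is_label n (l : 'I_n -> R) := forall i, l i = 1 \/ l i = -1.

Definition outer n (l : 'I_n -> R) : 'M[R]_n := \matrix_(i, j) (l i * l j).

Definition agree n (l l' : 'I_n -> R) : nat := #|[set i | l i == l' i]|.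

Definition subm n (S T : {set 'I_n}) (A : 'M[R]_n) : 'M[R]_(#|S|, #|T|) :=
  \matrix_(i < #|S|, j < #|T|) A (enum_val i) (enum_val j).

Definition norm2 m (v : 'cV[R]_m) : R := Num.sqrt (\sum_i v i 0 ^+ 2).

Definition opnorm_le m (Y : 'M[R]_m) (c : R) :=
  forall v : 'cV[R]_m, norm2 (Y *m v) <= c * norm2 v.

(* ||M||_1 <= c, with ||M||_1 = tr |M|, |M| = the PSD square root of M^T M *)
Definition psd m (P : 'M[R]_m) := forall v : 'cV[R]_m, 0 <= (v^T *m P *m v) 0 0.
Definition tracenorm_le m (M : 'M[R]_m) (c : R) :=
  exists P : 'M[R]_m, [/\ P^T = P, psd P, P *m P = M^T *m M & \tr P <= c].

Definition Ymat n (x : 'I_n -> R) : 'M[R]_n := \matrix_(i, j) x i.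

Definition resolvable m (X : 'M[R]_m) (d1 d2 : R) :=
  forall x : 'I_m -> R, (forall i, 0 <= x i <= 1) ->
    \sum_i x i <= 10 ^- 6 * m%:R ->
    frob X (Ymat x) >= d1 * (\sum_i x i) - d2 * m%:R.

Definition pseudorect n (theta : R) (M : 'M[R]_n) :=
  [/\ forall i j, 0 <= M i j <= 1,
      \sum_i \sum_j `|M i j| <= theta ^+ 2 * n%:R ^+ 2
    & tracenorm_le M (theta * n%:R)].

Definition rowsel n (theta delta : R) (M : 'M[R]_n) (x : 'I_n -> R) :=
  [/\ forall i j, 0 <= M i j <= 1,
      forall i, 0 <= x i <= 1,
      \sum_i x i <= theta * n%:R
    & exists N, pseudorect (Num.sqrt (theta * delta)) N /\ M = Ymat x - N].

Definition sdp_feasible n (Ahat : 'M[R]_n) (l : 'I_n -> R) (zeta d K : R)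
  (rho : R) (w : 'I_n -> R) (W N : 'M[R]_n) :=
  [/\ 0 <= rho <= zeta,
      pseudorect rho N,
      forall i, 0 <= w i <= 1,
      \sum_i w i <= rho * n%:R
    & [/\ forall i j, 0 <= W i j,
      forall i j, W i j = 1 - w i - w j + N i j
    & forall rho', rho / K <= rho' <= zeta ->
        forall M x, rowsel rho' (K * rho') M x ->
          frob (hadamard (hadamard Ahat (outer l)) W) M >=
          10 * d * K ^+ 2 * (K * (\sum_i x i * (1 - w i)) - rho' * n%:R)]].

Definition sdp_optimal n (Ahat : 'M[R]_n) (l : 'I_n -> R) (zeta d K : R)
  (rho : R) (w : 'I_n -> R) (W N : 'M[R]_n) :=
  sdp_feasible Ahat l zeta d K rho w W N /\
  forall rho2 w2 W2 N2, sdp_feasible Ahat l zeta d K rho2 w2 W2 N2 -> rho <= rho2.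

Definition flip n (K : R) (l w : 'I_n -> R) : 'I_n -> R :=
  fun i => if 1 - (Num.sqrt K)^-1 <= w i then - l i else l i.

Definition boosting_run n (Ahat : 'M[R]_n) (zeta d K : R) (linit : 'I_n -> R)
  (T : nat) (ls : nat -> 'I_n -> R) :=
  ls 0%N = linit /\
  forall t, (t < T)%N ->
    exists rho w W N, sdp_optimal Ahat (ls t) zeta d K rho w W N /\
                      ls t.+1 = flip K (ls t) w.

End Defs.

(* Main.v *)
(** Write X = (Ahat - F) o (ltil ltil^T), and for a labelling l let E be the set of wrong
    coordinates in S and T = S \ E.  The truth gives a feasible point of the SDP: w is the
    indicator of the complement of T and W = 1_T 1_T^T, with value rho = gamma + |E|/n; the
    constraints hold because F has the right sign on T x T, X is resolvable, and the
    pseudorectangle part of a row selector correlates little with X, by duality of the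
    operator and trace norms.  Conversely, let U be the coordinates of E which an optimal
    solution does not flip.  If |U| > rho n / 10, then 1_U 1_T^T is an admissible test matrix
    on which the signal has the wrong sign, and every noise term is O(K d |U|), against the
    required 10 d K^2 (sqrt K - 1) |U|.  So a round sends |E| to at most
    5/4 gamma n + |E|/4; after 10 log n rounds at most 8/3 gamma n + 1/10 errors remain, and
    integrality turns this into 8 gamma n. *)
Require Import Defs.
From HB Require Import structures.
From mathcomp Require Import all_boot all_order all_algebra.
From mathcomp Require Import all_classical all_reals sequences exp.
From mathcomp Require Import ring lra.
Import Order.TTheory GRing.Theory Num.Theory.
Local Open Scope ring_scope.

Set Implicit Arguments.
Unset Strict Implicit.

(** * Duality between the operator norm and the trace norm *)

Section TraceDuality.
Context {R : realType}.

Definition sqnorm {n} (u : 'I_n -> R) : R := \sum_i u i ^+ 2.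

(** For [c >= 0], rescaling [u] against [v] shows this to be the operator norm bound [c]. The
    symmetric form avoids square roots and adds up over families of vector pairs. *)
Definition bilin_le {n} (Y : 'M[R]_n) (c : R) :=
  forall u v : 'I_n -> R,
    \sum_i \sum_j u i * Y i j * v j <= c / 2 * (sqnorm u + sqnorm v).

Lemma sqnorm_ge0 n (u : 'I_n -> R) : 0 <= sqnorm u.
Proof. by apply: sumr_ge0 => i _; exact: sqr_ge0. Qed.

Lemma dotmxE n (u : 'cV[R]_n) : (u^T *m u) 0 0 = sqnorm (fun i => u i 0).
Proof. by rewrite mxE; apply: eq_bigr => i _; rewrite !mxE expr2. Qed.

Lemma tr_outer n (u : 'cV[R]_n) : \tr (u *m u^T) = sqnorm (fun i => u i 0).
Proof. by rewrite mxtrace_mulC -dotmxE /mxtrace big_ord1. Qed.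

Lemma psd_diag n (P : 'M[R]_n) (i : 'I_n) : psd P -> 0 <= P i i.
Proof.
move=> psdP; have := psdP (delta_mx i 0).
rewrite trmx_delta -rowE -colE.
by rewrite !mxE.
Qed.

(** On [e_j + t e_i] the quadratic form is affine in [t] with slope [2 P_ij], so it stays
    nonnegative for all [t] only if the slope vanishes. *)
Lemma psd_diag0 n (P : 'M[R]_n) (i j : 'I_n) :
  P^T = P -> psd P -> P i i = 0 -> P i j = 0.
Proof.
move=> symP psdP Pii0.
have Pji : P j i = P i j by rewrite -{1}symP mxE.
have Pjj := psd_diag j psdP.
have quad t : 0 <= P j j + 2 * t * P i j.
  have := psdP (delta_mx j 0 + t *: delta_mx i 0).
  rewrite [(_ + _)^T]linearD /= [(t *: _)^T]linearZ /= !trmx_delta !mulmxDl !mulmxDr -!scalemxAl -!scalemxAr.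
  rewrite -!rowE -!colE !mxE Pji Pii0; lra.
apply/eqP; apply: contraT => Pij0.
(* This [t] gives the form the value [-1]. *)
have := quad (- (P j j + 1) / (2 * P i j)).
have -> : 2 * (- (P j j + 1) / (2 * P i j)) * P i j = - (P j j + 1) by field.
lra.
Qed.

(* Each step subtracts the rank-one matrix that clears row and column [i]; keeping
   the vectors in the range of [P] makes a later factorization through [P] automatic. *)
Lemma psd_gram n (P : 'M[R]_n) : P^T = P -> psd P ->
  exists s : seq 'cV[R]_n, P = \sum_(u <- s) (P *m u) *m (P *m u)^T.
Proof.
have [k] := ubnP #|[set i | P i i != 0]|; elim: k P => // k IHk P cardP symP psdP.
have [diag0|[i Pii]] : (forall i, P i i = 0) \/ exists i, P i i != 0.
- case: (pickP (fun i => P i i != 0)) => [i ?|diag0]; first by right; exists i.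
  by left => i; apply/eqP; have := diag0 i; case: eqP.
- exists [::]; rewrite big_nil; apply/matrixP => i j.
  by rewrite (psd_diag0 _ symP) ?mxE.
have Pii_gt0 : 0 < P i i by rewrite lt_def Pii psd_diag.
pose r := Num.sqrt (P i i); have r0 : r != 0 by rewrite sqrtr_eq0 -ltNge.
have rr : r * r = P i i by rewrite -expr2 sqr_sqrtr // ltW.
pose e : 'cV[R]_n := r^-1 *: delta_mx i 0; pose p := P *m e.
have pE : p = r^-1 *: col i P by rewrite /p /e -scalemxAr -colE.
have pTE : p^T = e^T *m P by rewrite trmx_mul symP.
have epE : e^T *m p = 1%:M.
  rewrite pE /e [(_ *: _)^T]linearZ /= trmx_delta -scalemxAr -scalemxAl -rowE scalerA.
  apply/matrixP => a b; rewrite !ord1 !mxE eqxx mulr1n -rr; by field.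
have peE : p^T *m e = 1%:M by rewrite -[LHS]trmxK trmx_mul trmxK epE trmx1.
have pEl b : p b 0 = r^-1 * P b i by rewrite pE !mxE.
have pdef : P *m e = p by [].
clearbody p; clearbody e.
pose Q := P - p *m p^T.
have symQ : Q^T = Q by rewrite linearB /= trmx_mul trmxK symP.
have QE a b : Q a b = P a b - P a i * P i b / P i i.
  rewrite !(mxE, big_ord1) !pEl -rr.
  have -> : P b i = P i b by rewrite -{1}symP mxE.
  by field.
have psdQ : psd Q.
  move=> v; pose t := (p^T *m v) 0 0.
  have vpE : v^T *m p = (t : R)%:M.
    by rewrite -[v^T *m p]trmxK trmx_mul trmxK [p^T *m v]mx11_scalar tr_scalar_mx.
  have pvE : p^T *m v = (t : R)%:M by rewrite [LHS]mx11_scalar.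
  (* Since [e^T P e = 1], the vector [v - t e] is the part of [v] that is [P]-orthogonal to [e]; so
     [Q] inherits positivity from [P]. *)
  have <- : (v - t *: e)^T *m P *m (v - t *: e) = v^T *m Q *m v.
    rewrite [(v - _)^T]linearB /= [(t *: e)^T]linearZ /= mulmxBl -scalemxAl -pTE.
    rewrite mulmxBr !mulmxBl -!scalemxAl -!scalemxAr peE pvE.
    rewrite -[v^T *m P *m e]mulmxA pdef vpE /Q mulmxBr mulmxBl.
    rewrite [v^T *m (p *m _)]mulmxA vpE -(mulmxA t%:M) pvE -!mulmxA.
    apply/matrixP => a b; rewrite !ord1 !(mxE, big_ord1) eqxx !mulr1n; ring.
  exact: psdP.
have cardQ : (#|[set a | Q a a != 0%R]| < k)%N.
  rewrite -ltnS; apply: leq_trans cardP; rewrite ltnS; apply: proper_card; apply/properP; split.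
    apply/fintype.subsetP => a; rewrite !inE; apply: contra => /eqP Paa.
    by rewrite QE (psd_diag0 i symP psdP Paa) Paa mul0r mul0r subr0.
  by exists i; rewrite !inE // QE mulfK // subrr eqxx.
have [s Qs] := IHk Q cardQ symQ psdQ.
(* The correction along [e] makes [P] act on the new vector as [Q] acts on [u]. *)
exists (e :: [seq u - (p^T *m u) 0 0 *: e | u <- s]).
rewrite big_cons big_map pdef.
have -> : \sum_(u <- s) (P *m (u - (p^T *m u) 0 0 *: e)) *m (P *m (u - (p^T *m u) 0 0 *: e))^T = Q.
  rewrite {}Qs; apply: eq_bigr => u _.
  have -> // : P *m (u - (p^T *m u) 0 0 *: e) = Q *m u.
  rewrite mulmxBr -scalemxAr pdef mulmxBl -mulmxA {2}[p^T *m u]mx11_scalar.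
  by rewrite mul_mx_scalar.
by rewrite addrC subrK.
Qed.

Lemma sqnorm_eq0 n (u : 'cV[R]_n) : sqnorm (fun i => u i 0) = 0 -> u = 0.
Proof.
move=> /eqP; rewrite psumr_eq0 => [/allP u0|i _]; last exact: sqr_ge0.
apply/matrixP => i j; rewrite ord1 mxE.
by have := u0 i (mem_index_enum i); rewrite /= sqrf_eq0 => /eqP.
Qed.

(** A Gram decomposition of [P = |N|] takes the place of the singular value decomposition: [P] is
    the sum of [(P u)(P u)^T] and [N] the sum of [(N u)(P u)^T], with [|N u| = |P u|]. Each term
    pairs with [Y] to at most [c |P u|^2], and these squares sum to the trace of [P]. *)
Lemma trace_duality n (Y N : 'M[R]_n) (c t : R) : 0 <= c ->
  bilin_le Y c -> tracenorm_le N t -> frob Y N <= c * t.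
Proof.
move=> c0 bY [P [symP psdP PP trP]].
have normE (u : 'cV[R]_n) :
    sqnorm (fun i => (N *m u) i 0) = sqnorm (fun i => (P *m u) i 0).
  rewrite -!dotmxE !trmx_mul symP !mulmxA -(mulmxA u^T) -PP.
  by rewrite !mulmxA.
have [s Ps] := psd_gram symP psdP.
have NE : N = \sum_(u <- s) (N *m u) *m (P *m u)^T.
  have -> : \sum_(u <- s) (N *m u) *m (P *m u)^T = N *m (\sum_(u <- s) u *m (P *m u)^T).
    by rewrite mulmx_sumr; apply: eq_bigr => u _; rewrite mulmxA.
  set G := \sum_(u <- s) _.
  have PG : P *m (1%:M - G) = 0.
    rewrite mulmxBr mulmx1 {1}Ps mulmx_sumr -sumrB big1 // => u _.
    by rewrite mulmxA subrr.
  (* [N] vanishes wherever [P] does, because [|N v| = |P v|]. *)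
  have NG : N *m (1%:M - G) = 0.
    apply/matrixP => i j; rewrite [RHS]mxE.
    have : N *m col j (1%:M - G) = 0.
      by apply: sqnorm_eq0; rewrite normE colE mulmxA PG mul0mx; apply: big1 => a _; rewrite mxE expr0n.
    by rewrite colE mulmxA -colE => /matrixP /(_ i 0); rewrite !mxE.
  by apply/eqP; rewrite -subr_eq0 -{1}[N]mulmx1 -mulmxBr NG.
have frobE : frob Y N = \sum_(u <- s) \sum_i \sum_j (N *m u) i 0 * Y i j * (P *m u) j 0.
  rewrite /frob [RHS]exchange_big /=; apply: eq_bigr => i _.
  rewrite [RHS]exchange_big /=; apply: eq_bigr => j _.
  rewrite {1}NE summxE mulr_sumr; apply: eq_bigr => u _.
  by rewrite mxE big_ord1 [(P *m u)^T _ _]mxE; ring.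
have trE : \tr P = \sum_(u <- s) sqnorm (fun i => (P *m u) i 0).
  by rewrite {1}Ps raddf_sum; apply: eq_bigr => u _; exact: tr_outer.
apply: le_trans (ler_wpM2l c0 trP); rewrite frobE trE mulr_sumr.
apply: ler_sum => u _; apply: le_trans (bY _ _) _.
by rewrite normE; lra.
Qed.

Lemma norm2_sq m (v : 'cV[R]_m) : norm2 v ^+ 2 = sqnorm (fun i => v i 0).
Proof. by rewrite sqr_sqrtr // sqnorm_ge0. Qed.

(** AM-GM with weight [c] balances [|u|^2] against [|Y v|^2 <= c^2 |v|^2]. *)
Lemma opnorm_bilin m (Y : 'M[R]_m) (c : R) : 0 < c -> opnorm_le Y c -> bilin_le Y c.
Proof.
move=> c0 opY u v; pose V : 'cV[R]_m := \col_i v i.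
have VE : sqnorm v = sqnorm (fun i => V i 0) by apply: eq_bigr => i _; rewrite mxE.
have YV : sqnorm (fun i => (Y *m V) i 0) <= c ^+ 2 * sqnorm v.
  rewrite VE -!norm2_sq -exprMn lerXn2r ?nnegrE ?sqrtr_ge0 //.
  by rewrite mulr_ge0 ?sqrtr_ge0 // ltW.
have -> : \sum_i \sum_j u i * Y i j * v j = \sum_i u i * (Y *m V) i 0.
  apply: eq_bigr => i _; rewrite mxE mulr_sumr; apply: eq_bigr => j _.
  by rewrite mxE mulrA.
have amgm : \sum_i u i * (Y *m V) i 0 <=
    c / 2 * sqnorm u + (2 * c)^-1 * sqnorm (fun i => (Y *m V) i 0).
  rewrite /sqnorm !mulr_sumr -big_split /=; apply: ler_sum => i _.
  set a := u i; set b := (Y *m V) i 0.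
  have -> : c / 2 * a ^+ 2 + (2 * c)^-1 * b ^+ 2 = a * b + (c * a - b) ^+ 2 / (2 * c).
    by field; rewrite gt_eqF.
  by rewrite lerDl divr_ge0 ?sqr_ge0 //; lra.
apply: le_trans amgm _; rewrite mulrDr lerD2l.
have c2 : 0 <= (2 * c)^-1 by rewrite invr_ge0; lra.
apply: le_trans (ler_wpM2l c2 YV) _.
have -> : (2 * c)^-1 * (c ^+ 2 * sqnorm v) = c / 2 * sqnorm v by field; rewrite gt_eqF.
by [].
Qed.

End TraceDuality.

(** * Bounds on the noise matrix, and indicator rectangles as pseudorectangles *)

Section Noise.
Context {R : realType} {n : nat}.
Implicit Types (S T : {set 'I_n}) (X Y Z N : 'M[R]_n) (a b x : 'I_n -> R) (c z th al be : R).

Definition ind S (i : 'I_n) : R := (i \in S)%:R.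

Lemma ind_01 S i : 0 <= ind S i <= 1.
Proof. by rewrite /ind; case: (i \in S); rewrite ?lexx ?ler01. Qed.

Lemma ind_norm S i : `|ind S i| <= 1.
Proof. by rewrite /ind; case: (i \in S); rewrite ?normr1 // normr0. Qed.

Lemma sum_indM S a : \sum_i ind S i * a i = \sum_(i in S) a i.
Proof.
rewrite [RHS]big_mkcond; apply: eq_bigr => i _; rewrite /ind.
by case: (i \in S); rewrite ?mul1r ?mul0r.
Qed.

Lemma sum_ind S : \sum_i ind S i = #|S|%:R.
Proof.
rewrite -sum1_card natr_sum -sum_indM; apply: eq_bigr => i _.
by rewrite mulr1.
Qed.

Lemma sum_enum_val S a : \sum_(i < #|S|) a (enum_val i) = \sum_i ind S i * a i.
Proof. by rewrite sum_indM [RHS]big_enum_val. Qed.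

(* [X] on [S] is an operator-norm part plus an entrywise small part, as in
   hypothesis (3), the parts being extended outside [S] x [S]. *)
Definition opsplit S X (c z : R) := exists Y Z,
  [/\ forall i j, i \in S -> j \in S -> X i j = Y i j + Z i j,
      bilin_le Y c & forall i j, `|Z i j| <= z].

(** The masks are absorbed into the test vectors, whose norms they do not increase. *)
Lemma bilin_le_mask Y c a b : 0 <= c -> (forall i, `|a i| <= 1) -> (forall i, `|b i| <= 1) ->
  bilin_le Y c -> bilin_le (\matrix_(i, j) (a i * Y i j * b j)) c.
Proof.
move=> c0 a1 b1 bY u v.
have sqle (e f : 'I_n -> R) : (forall i, `|e i| <= 1) -> sqnorm (fun i => f i * e i) <= sqnorm f.
  move=> e1; apply: ler_sum => i _; rewrite exprMn -[leRHS]mulr1 ler_wpM2l ?sqr_ge0 //.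
  by rewrite -[e i ^+ 2]ger0_norm ?sqr_ge0 // normrX expr_le1.
have := bY (fun i => u i * a i) (fun i => v i * b i).
have -> : \sum_i \sum_j u i * a i * Y i j * (v j * b j) =
          \sum_i \sum_j u i * (\matrix_(i, j) (a i * Y i j * b j)) i j * v j.
  by apply: eq_bigr => i _; apply: eq_bigr => j _; rewrite mxE; ring.
move/le_trans; apply; apply: ler_wpM2l; first by rewrite divr_ge0.
by apply: lerD; apply: sqle.
Qed.

Lemma opsplit_sub S X c z : 0 < c -> 0 <= z ->
  (exists Y Z : 'M[R]_#|S|,
     [/\ subm S S X = Y + Z, opnorm_le Y c & forall i j, `|Z i j| <= z]) ->
  opsplit S X c z.
Proof.
move=> c0 z0 [Y [Z [XYZ opY Zz]]].
have bY := opnorm_bilin c0 opY.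
(* [enum_rank_in] below needs an element of [S]. *)
have [S0|[s sS]] := set_0Vmem S.
  exists 0, 0; split=> [i j|u v|i j]; first by rewrite S0 inE.
    have c2 : 0 <= c / 2 by rewrite divr_ge0 // ltW.
    rewrite big1 => [|i _]; first by rewrite mulr_ge0 // addr_ge0 // sqnorm_ge0.
    by rewrite big1 // => j _; rewrite mxE mulr0 mul0r.
  by rewrite mxE normr0.
pose r : 'I_n -> 'I_#|S| := enum_rank_in sS.
(* Outside [S] the rank [r] is only a default index. Hence [Y] is masked to keep its bilinear bound,
   while the entrywise bound on [Z] holds at any index. *)
exists (\matrix_(i, j) (ind S i * Y (r i) (r j) * ind S j)), (\matrix_(i, j) Z (r i) (r j)).
split=> [i j iS jS|u v|i j]; last by rewrite mxE.
  rewrite !mxE /ind iS jS mul1r mulr1 -[_ + _]/(Y (r i) (r j) + Z (r i) (r j)).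
  by move/matrixP: XYZ => /(_ (r i) (r j)); rewrite !mxE !enum_rankK_in.
have -> : \sum_i \sum_j u i * (\matrix_(i, j) (ind S i * Y (r i) (r j) * ind S j)) i j * v j =
    \sum_(i < #|S|) \sum_(j < #|S|) u (enum_val i) * Y i j * v (enum_val j).
  transitivity (\sum_(i in S) \sum_(j in S) u i * Y (r i) (r j) * v j).
    rewrite -sum_indM; apply: eq_bigr => i _; rewrite -sum_indM mulr_sumr.
    by apply: eq_bigr => j _; rewrite mxE; ring.
  rewrite big_enum_val; apply: eq_bigr => i _; rewrite big_enum_val.
  by apply: eq_bigr => j _; rewrite /r !enum_valK_in.
apply: le_trans (bY (fun i => u (enum_val i)) (fun i => v (enum_val i))) _.
apply: ler_wpM2l; first by rewrite divr_ge0 // ltW.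
have sqle (f : 'I_n -> R) : sqnorm (fun i : 'I_#|S| => f (enum_val i)) <= sqnorm f.
  rewrite /sqnorm (sum_enum_val S (fun i => f i ^+ 2)).
  apply: ler_sum => i _; have /andP[_ i1] := ind_01 S i.
  by rewrite -[leRHS]mul1r ler_wpM2r ?sqr_ge0.
by apply: lerD; apply: sqle.
Qed.

Lemma opsplit_sign S X c z a : 0 <= c -> (forall i, `|a i| = 1) ->
  opsplit S X c z -> opsplit S (hadamard X (outer a)) c z.
Proof.
move=> c0 a1 [Y [Z [XYZ bY Zz]]].
exists (\matrix_(i, j) (a i * Y i j * a j)), (\matrix_(i, j) (a i * Z i j * a j)); split.
- by move=> i j iS jS; rewrite !mxE XYZ //; ring.
- by apply: bilin_le_mask => // i; rewrite a1.
- by move=> i j; rewrite mxE !normrM !a1 mul1r mulr1.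
Qed.

Definition supp a S := forall i, i \notin S -> a i = 0.

(** Entries bounded by 1 make the squared norm at most the sum of absolute values, so [Y] costs a
    sum of the two masses and [Z] their product. *)
Lemma opsplit_bilin S X c z a b al be : 0 <= c -> 0 <= z -> opsplit S X c z ->
  supp a S -> supp b S ->
  (forall i, `|a i| <= 1) -> (forall i, `|b i| <= 1) ->
  \sum_i `|a i| <= al -> \sum_i `|b i| <= be ->
  \sum_i \sum_j a i * X i j * b j <= c / 2 * (al + be) + z * (al * be).
Proof.
move=> c0 z0 [Y [Z [XYZ bY Zz]]] aS bS a1 b1 alP beP.
have -> : \sum_i \sum_j a i * X i j * b j =
   \sum_i \sum_j a i * Y i j * b j + \sum_i \sum_j a i * Z i j * b j.
  rewrite -big_split; apply: eq_bigr => i _ /=; rewrite -big_split; apply: eq_bigr => j _ /=.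
  have [iS|/aS ->] := boolP (i \in S); last by ring.
  have [jS|/bS ->] := boolP (j \in S); last by ring.
  by rewrite XYZ //; ring.
have sqle (e : 'I_n -> R) : (forall i, `|e i| <= 1) -> sqnorm e <= \sum_i `|e i|.
  move=> e1; apply: ler_sum => i _.
  by rewrite -[_ ^+ 2]ger0_norm ?sqr_ge0 // normrX expr2 -[leRHS]mulr1 ler_wpM2l.
apply: lerD.
  apply: le_trans (bY a b) _; apply: ler_wpM2l; first by rewrite divr_ge0.
  by apply: lerD; [apply: le_trans alP | apply: le_trans beP]; apply: sqle.
apply: (@le_trans _ _ (z * ((\sum_i `|a i|) * \sum_j `|b j|))).
  rewrite mulr_suml mulr_sumr; apply: ler_sum => i _ /=.
  rewrite !mulr_sumr; apply: ler_sum => j _ /=.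
  apply: le_trans (ler_norm _) _; rewrite !normrM.
  have -> : `|a i| * `|Z i j| * `|b j| = `|Z i j| * (`|a i| * `|b j|) by ring.
  by apply: ler_wpM2r; rewrite ?mulr_ge0.
apply: ler_wpM2l => //; apply: ler_pM => //; exact: sumr_ge0.
Qed.

(** The trace norm of [N] controls the pairing with [Y], and its entrywise mass the pairing with
    [Z]. *)
Lemma opsplit_trace S X c z a b N th : 0 <= c -> 0 <= z -> opsplit S X c z ->
  supp a S -> supp b S ->
  (forall i, `|a i| <= 1) -> (forall i, `|b i| <= 1) -> pseudorect th N ->
  \sum_i \sum_j a i * X i j * b j * N i j <= c * (th * n%:R) + z * (th ^+ 2 * n%:R ^+ 2).
Proof.
move=> c0 z0 [Y [Z [XYZ bY Zz]]] aS bS a1 b1 [N01 N1 Ntr].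
have -> : \sum_i \sum_j a i * X i j * b j * N i j =
   frob (\matrix_(i, j) (a i * Y i j * b j)) N + \sum_i \sum_j a i * Z i j * b j * N i j.
  rewrite -big_split; apply: eq_bigr => i _ /=; rewrite -big_split; apply: eq_bigr => j _ /=.
  rewrite mxE.
  have [iS|/aS ->] := boolP (i \in S); last by ring.
  have [jS|/bS ->] := boolP (j \in S); last by ring.
  by rewrite XYZ //; ring.
apply: lerD; first by apply: trace_duality => //; exact: bilin_le_mask.
apply: le_trans (ler_wpM2l z0 N1).
rewrite mulr_sumr; apply: ler_sum => i _; rewrite mulr_sumr; apply: ler_sum => j _.
apply: le_trans (ler_norm _) _; rewrite !normrM; apply: ler_wpM2r => //.
rewrite -[leRHS]mulr1 -[z in leRHS]mul1r.
by rewrite !ler_pM ?mulr_ge0.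
Qed.

Lemma resolvable_subm T X d1 d2 x : resolvable (subm T T X) d1 d2 ->
  (forall i, 0 <= x i <= 1) -> \sum_i ind T i * x i <= 10 ^- 6 * #|T|%:R ->
  d1 * (\sum_i ind T i * x i) - d2 * #|T|%:R <=
  \sum_i \sum_j ind T i * X i j * ind T j * x i.
Proof.
move=> res x01; rewrite -sum_enum_val => xT.
have := res (fun i => x (enum_val i)) (fun i => x01 _) xT.
congr (_ <= _); rewrite /frob.
transitivity (\sum_i ind T i * \sum_j ind T j * (X i j * x i)).
  rewrite -sum_enum_val; apply: eq_bigr => i _; rewrite -sum_enum_val.
  by apply: eq_bigr => j _; rewrite !mxE.
apply: eq_bigr => i _; rewrite mulr_sumr.
by apply: eq_bigr => j _; ring.
Qed.

(** The absolute value of [a b^T] is [k b b^T] with [k = |a| / |b|], and its trace is [|a| |b|]. *)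
Lemma tracenorm_rank1 a b (t : R) : 0 <= t -> sqnorm a * sqnorm b <= t ^+ 2 ->
  tracenorm_le (\matrix_(i, j) (a i * b j)) t.
Proof.
move=> t0 abt.
pose A := sqnorm a; pose B := sqnorm b.
have A0 : 0 <= A := sqnorm_ge0 a. have B0 : 0 <= B := sqnorm_ge0 b.
pose k := Num.sqrt A / Num.sqrt B.
have k0 : 0 <= k by rewrite divr_ge0 ?sqrtr_ge0.
have [Bz|Bnz] := eqVneq B 0.
  have b0 j : b j = 0.
    have /eqP := Bz; rewrite psumr_eq0 => [/allP h|i _]; last exact: sqr_ge0.
    by have := h j (mem_index_enum j); rewrite /= sqrf_eq0 => /eqP.
  exists 0; split; rewrite ?trmx0 ?mxtrace0 //.
  - by move=> v; rewrite mulmx0 mul0mx mxE.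
  - rewrite mul0mx; apply/matrixP => i j; rewrite !mxE big1 // => m _.
    by rewrite !mxE b0 mulr0 mul0r.
have kk : k ^+ 2 * B = A by rewrite /k exprMn exprVn !sqr_sqrtr // divfK.
exists (\matrix_(i, j) (k * (b i * b j))); split.
- by apply/matrixP => i j; rewrite !mxE; ring.
- move=> v.
  have -> : (v^T *m \matrix_(i, j) (k * (b i * b j)) *m v) 0 0 = k * (\sum_i b i * v i 0) ^+ 2.
    rewrite mxE expr2 mulr_suml mulr_sumr; apply: eq_bigr => i _.
    rewrite mxE mulr_suml !mulr_sumr; apply: eq_bigr => j _.
    by rewrite !mxE; ring.
  by rewrite mulr_ge0 ?sqr_ge0.
- apply/matrixP => i j; rewrite !mxE.
  transitivity (k ^+ 2 * B * (b i * b j)).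
    rewrite -mulrA [B * _]mulrC /B /sqnorm !mulr_sumr; apply: eq_bigr => m _.
    by rewrite !mxE; ring.
  rewrite kk /A /sqnorm mulr_suml; apply: eq_bigr => m _; rewrite !mxE; ring.
- have -> : \tr (\matrix_(i, j) (k * (b i * b j))) = k * B.
    by rewrite /mxtrace /B /sqnorm mulr_sumr; apply: eq_bigr => i _; rewrite mxE expr2.
  rewrite -(@ler_pXn2r _ 2) ?nnegrE ?(mulr_ge0 k0) //.
  by rewrite exprMn [B ^+ 2]expr2 mulrA kk.
Qed.

(** The rectangle has mass [|U| |V|] and trace norm the square root of it, so one inequality serves
    both conditions. *)
Lemma ind_rect_pseudorect (U V : {set 'I_n}) th : 0 <= th -> #|U|%:R * #|V|%:R <= (th * n%:R) ^+ 2 ->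
  pseudorect th (\matrix_(i, j) (ind U i * ind V j)).
Proof.
move=> th0 UV.
have sqi S : sqnorm (ind S) = #|S|%:R.
  rewrite -sum_ind; apply: eq_bigr => i _; rewrite /ind.
  by case: (i \in S); rewrite ?expr1n ?expr0n.
split.
- move=> i j; rewrite mxE; have /andP[? ?] := ind_01 U i; have /andP[? ?] := ind_01 V j.
  by rewrite mulr_ge0 //= mulr_ile1.
- rewrite -exprMn; apply: le_trans UV; rewrite -!sum_ind mulr_suml.
  apply: ler_sum => i _; rewrite mulr_sumr; apply: ler_sum => j _.
  by rewrite mxE normrM !ger0_norm //; have /andP[] := ind_01 U i; have /andP[] := ind_01 V j.
- by apply: tracenorm_rank1; rewrite ?mulr_ge0 // !sqi.
Qed.

End Noise.

(* The hypotheses of the theorem, with [X] for [(Ahat - F) o (ltil ltil^T)]. *)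
Record boosting_data {R : realType} {n : nat} (X : 'M[R]_n) (S : {set 'I_n})
    (zeta d K gamma : R) : Prop := BoostingData {
  n_gt0 : 0 < n%:R :> R;
  zeta_gt0 : 0 < zeta;
  zeta_lt1 : zeta < 1;
  d_gt0 : 0 < d;
  K_ge : 10 ^+ 4 <= K;
  gamma_le : gamma <= zeta / 10;
  cardS_ge : (1 - gamma) * n%:R <= #|S|%:R;
  X_split : opsplit S X (K * d) (K * d / (zeta * n%:R));
  X_resolvable : forall T : {set 'I_n}, T \subset S -> (1 - zeta) * n%:R <= #|T|%:R ->
    resolvable (subm T T X) (10 * d * K ^+ 3)
      (1 / 2 * d * K * (gamma + (n%:R - #|T|%:R) / n%:R)) }.

(** * The true labelling gives a feasible point of the SDP *)

Section Boosting.
Context {R : realType} {n : nat}.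
Implicit Types (Ahat X M N W : 'M[R]_n) (l ltil w x : 'I_n -> R) (S T U : {set 'I_n}).
Implicit Types (zeta d K gamma : R).

Lemma card_leR T : #|T|%:R <= n%:R :> R.
Proof. by rewrite ler_nat -[leqRHS]card_ord max_card. Qed.

Lemma supp_indM S T x : T \subset S -> supp (fun i => ind T i * x i) S.
Proof.
move=> /fintype.subsetP TS i iS; rewrite /ind.
by case: (boolP (i \in T)) => [/TS|]; rewrite ?(negbTE iS) // mul0r.
Qed.

Lemma supp_ind S T : T \subset S -> supp (ind T : 'I_n -> R) S.
Proof.
move=> /fintype.subsetP TS i iS; rewrite /ind.
by case: (boolP (i \in T)) => // /TS; rewrite (negbTE iS).
Qed.

Lemma sum_norm_ind T : \sum_i `|ind T i| <= #|T|%:R :> R.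
Proof.
by rewrite -sum_ind; apply: ler_sum => i _; rewrite ger0_norm // ler0n.
Qed.

(* Resolvability at a constant selector contradicts the norm bounds on [X] unless
   [zeta] is tiny; this is what makes every selector of mass [zeta n] admissible below. *)
Lemma zeta_small X S zeta d K gamma : boosting_data X S zeta d K gamma ->
  zeta <= 1 / 10 ^+ 8.
Proof.
case=> n0 zeta0 zeta1 d0 K4 gammaz Sge Xs Xres.
have Kd0 : 0 < K * d by rewrite mulr_gt0 //; lra.
have z0 : 0 <= K * d / (zeta * n%:R) by rewrite divr_ge0 // ltW // mulr_gt0.
pose s : R := #|S|%:R.
have sn : s <= n%:R := card_leR S.
have zn : zeta * n%:R <= n%:R by rewrite ler_piMl ?ltW.
have s_gt0 : 0 < s.
  apply: lt_le_trans Sge; rewrite mulr_gt0 //. lra.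
have Sz : (1 - zeta) * n%:R <= s.
  by apply: le_trans Sge; rewrite ler_wpM2r ?ltW //; lra.
(* The constant selector [10^-6] has the largest mass that resolvability allows. *)
have x01 : 0 <= (10 ^- 6 : R) <= 1.
  by rewrite invr_ge0 exprn_ge0 //= invf_le1 ?exprn_ege1 ?exprn_gt0 // ler1n.
have xS : \sum_i ind S i * (10 ^- 6 : R) = 10 ^- 6 * s by rewrite -mulr_suml sum_ind mulrC.
have := resolvable_subm (Xres _ (subxx _) Sz) (fun _ => x01) _.
rewrite xS => /(_ (lexx _)).
have -> : \sum_i \sum_j ind S i * X i j * ind S j * (10 ^- 6 : R) =
    10 ^- 6 * \sum_i \sum_j ind S i * X i j * ind S j.
  rewrite mulr_sumr; apply: eq_bigr => i _; rewrite mulr_sumr; apply: eq_bigr => j _.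
  by rewrite mulrC.
have B := opsplit_bilin (ltW Kd0) z0 Xs (supp_ind (subxx S)) (supp_ind (subxx S))
  (ind_norm S) (ind_norm S) (sum_norm_ind S) (sum_norm_ind S).
move: B; set B := \sum_i _; rewrite -/s => B_le A_le.
pose r := s / n%:R.
have r1 : r <= 1 by rewrite ler_pdivrMr // mul1r.
have rg : 1 - gamma <= r by rewrite ler_pdivlMr.
have r0 : 0 < r by rewrite divr_gt0.
have dE : (n%:R - s) / n%:R = 1 - r by rewrite mulrBl divff // gt_eqF.
have zE : K * d / (zeta * n%:R) * (s * s) = K * d * s * (r / zeta).
  by rewrite /r; field; rewrite !gt_eqF.
have main : K * d * s * (10 * K ^+ 2 - 10 ^+ 6 / 2 * (gamma + (1 - r))) <=
    K * d * s * (1 + r / zeta).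
  have e6 : 0 <= 10 ^+ 6 :> R by rewrite exprn_ge0.
  have := ler_wpM2l e6 A_le; rewrite mulVKf ?expf_neq0 ?pnatr_eq0 //.
  rewrite mulrBr [10 ^+ 6 * (10 * d * K ^+ 3 * _)]mulrCA mulVKf ?expf_neq0 ?pnatr_eq0 //.
  by rewrite dE; move: B_le; rewrite zE; lra.
rewrite ler_pM2l ?(mulr_gt0 Kd0) // in main.
have rz : r / zeta <= zeta^-1 by rewrite ler_piMl // invr_ge0 ltW.
(* The subtracted term is at most [10^5], since [gamma + (1 - r) <= 2 gamma <= 1/5]; so
   [10 K^2 >= 10^9] forces [1 / zeta] to be large. *)
have K2 : 10 ^+ 8 <= K ^+ 2 by rewrite -[8%N]/(4 * 2)%N exprM lerXn2r ?nnegrE; lra.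
have : 10 ^+ 8 <= zeta^-1 by lra.
by move=> h; rewrite div1r -[zeta]invrK lef_pV2 // ?posrE ?invr_gt0 ?exprn_gt0.
Qed.

Lemma gamma_ge0 X S zeta d K gamma : boosting_data X S zeta d K gamma -> 0 <= gamma.
Proof.
move=> H; have := le_trans (cardS_ge H) (card_leR S).
by rewrite -{2}[n%:R]mul1r ler_pM2r ?(n_gt0 H) //; lra.
Qed.

(** Smallness of [zeta] puts every selector of mass [zeta n] below the threshold [10^-6 |T|].
    Replacing [|T|] by [n] in the loss term clears its denominator. *)
Lemma resolvable_sum X S zeta d K gamma T x : boosting_data X S zeta d K gamma ->
  T \subset S -> (1 - zeta) * n%:R <= #|T|%:R -> (forall i, 0 <= x i <= 1) ->
  \sum_i ind T i * x i <= zeta * n%:R ->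
  10 * d * K ^+ 3 * (\sum_i ind T i * x i) - d * K / 2 * (gamma * n%:R + (n%:R - #|T|%:R)) <=
  \sum_i \sum_j ind T i * X i j * ind T j * x i.
Proof.
move=> H TS Tge x01 xT; have g0 := gamma_ge0 H; have zs := zeta_small H.
have Tn := card_leR T.
case: H => n0 zeta0 _ d0 K4 _ _ _ Xres.
apply: le_trans (resolvable_subm (Xres T TS Tge) x01 _); last first.
  apply: le_trans xT _; rewrite [leRHS]mulrC ler_pdivlMr ?exprn_gt0 //.
  apply: le_trans Tge; rewrite mulrAC ler_wpM2r ?(ltW n0) //.
  by move: zs; rewrite -(@ler_pM2l _ (10 ^+ 8)) ?exprn_gt0 //; lra.
rewrite lerD2l lerN2.
set D := n%:R - _; have D0 : 0 <= D by rewrite subr_ge0.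
have -> : gamma * n%:R + D = (gamma + D / n%:R) * n%:R by field; rewrite gt_eqF.
rewrite [X in _ <= X]mulrA.
rewrite [1 / 2 * d * K](_ : _ = d * K / 2); last by field.
have K0 : 0 < K by lra.
apply: ler_wpM2l => //; rewrite mulr_ge0 ?addr_ge0 ?divr_ge0 ?(ltW n0) // mulr_ge0 ?(ltW d0) ?(ltW K0) //.
Qed.

Definition correct S ltil l : {set 'I_n} := S :&: [set i | l i == ltil i].
Definition wrong S ltil l : {set 'I_n} := S :\: [set i | l i == ltil i].

Lemma card_correct_wrong S ltil l :
  #|correct S ltil l|%:R + #|wrong S ltil l|%:R = #|S|%:R :> R.
Proof. by rewrite -natrD cardsID. Qed.

Lemma card_setC T : #|~: T|%:R = n%:R - #|T|%:R :> R.
Proof.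
have /(congr1 (fun k => k%:R : R)) := cardsC T; rewrite card_ord natrD => <-.
by rewrite addrAC subrr add0r.
Qed.

(** Resolvability supplies the main term [10 d K^3] times the selector mass on [T]. The three
    losses, namely the resolvability slack and the [Y] and [Z] parts of the noise against [N], are
    each at most [d K^2 rho' n], while the constraint tolerates ten times that. *)
Lemma sdp_feasible_truth Ahat X S ltil zeta d K gamma l :
  boosting_data X S zeta d K gamma ->
  (forall i j, i \in S -> j \in S -> X i j <= Ahat i j * (ltil i * ltil j)) ->
  let T := correct S ltil l in
  let rho := gamma + #|wrong S ltil l|%:R / n%:R in
  rho <= zeta ->
  sdp_feasible Ahat l zeta d K rho (ind (~: T)) (\matrix_(i, j) (ind T i * ind T j))
    (\matrix_(i, j) (ind (~: T) i * ind (~: T) j)).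
Proof.
move=> H AX T rho rhoz; have g0 := gamma_ge0 H; have zs := zeta_small H.
have [n0 zeta0 zeta1 d0 K4 gz Sge Xs _] := H.
have K0 : 0 < K by lra.
have e0 : 0 <= #|wrong S ltil l|%:R :> R by rewrite ler0n.
have rn : rho * n%:R = gamma * n%:R + #|wrong S ltil l|%:R.
  by rewrite /rho; field; rewrite gt_eqF.
have TE := card_correct_wrong S ltil l; rewrite -/T in TE.
have rho0 : 0 <= rho by rewrite addr_ge0 // divr_ge0 // ltW.
have cTn : #|~: T|%:R <= rho * n%:R by rewrite card_setC rn; lra.
have TS : T \subset S by exact: subsetIl.
have rzn : rho * n%:R <= zeta * n%:R by rewrite ler_wpM2r // ltW.
have Tge : (1 - zeta) * n%:R <= #|T|%:R.
  by move: cTn; rewrite card_setC; lra.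
have indC i : ind (~: T) i = 1 - ind T i :> R.
  by rewrite /ind inE; case: (i \in T); rewrite ?subrr ?subr0.
split; rewrite ?rho0 //.
- apply: ind_rect_pseudorect => //; rewrite -expr2 lerXn2r ?nnegrE ?ler0n ?mulr_ge0 //.
- exact: ind_01.
- by rewrite sum_ind.
split.
- by move=> i j; rewrite mxE; apply: mulr_ge0; [have /andP[] := @ind_01 R n T i | have /andP[] := @ind_01 R n T j].
- by move=> i j; rewrite !mxE !indC; ring.
move=> rho' /andP[rho'1 rho'2] M x [M01 x01 xs [N [N_rect ME]]].
have rK : rho <= K * rho' by rewrite mulrC -ler_pdivrMr.
have rho'0 : 0 <= rho' by apply: le_trans rho'1; rewrite divr_ge0 // ltW.
have xT : \sum_i ind T i * x i <= zeta * n%:R.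
  apply: le_trans (le_trans xs _); last by rewrite ler_wpM2r // ltW.
  apply: ler_sum => i _; have /andP[x0 _] := x01 i; have /andP[_ t1] := @ind_01 R n T i.
  by rewrite -[leRHS]mul1r ler_wpM2r.
have res := resolvable_sum H TS Tge x01 xT.
set th := Num.sqrt _ in N_rect.
have th0 : 0 <= th by exact: sqrtr_ge0.
have thsq : th ^+ 2 = K * rho' ^+ 2.
  by rewrite sqr_sqrtr ?mulr_ge0 ?(ltW K0) //; ring.
have thK : th <= K * rho'.
  rewrite -(@ler_pXn2r _ 2) ?nnegrE ?mulr_ge0 ?(ltW K0) // thsq exprMn ler_wpM2r ?sqr_ge0 //.
  rewrite expr2 ler_peMl ?(ltW K0) //; lra.
have Kd0 : 0 < K * d by rewrite mulr_gt0.
have z0 : 0 <= K * d / (zeta * n%:R) by rewrite divr_ge0 // ltW // mulr_gt0.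
have noise := opsplit_trace (ltW Kd0) z0 Xs (supp_ind TS) (supp_ind TS)
  (ind_norm T) (ind_norm T) N_rect.
(* On [T x T] the labels [l] and [ltil] agree, so the signed [Ahat] dominates [X] there; [M] is
   nonnegative. *)
have low : \sum_i \sum_j ind T i * X i j * ind T j * x i -
    \sum_i \sum_j ind T i * X i j * ind T j * N i j <=
    frob (hadamard (hadamard Ahat (outer l)) (\matrix_(i, j) (ind T i * ind T j))) M.
  rewrite -sumrB; apply: ler_sum => i _; rewrite -sumrB; apply: ler_sum => j _.
  have MN : M i j = x i - N i j by rewrite ME !mxE.
  have /andP[M0 _] := M01 i j.
  rewrite -mulrBr -MN !mxE /ind.
  have [iT|_] := boolP (i \in T); last by rewrite !(mul0r, mulr0).
  have [jT|_] := boolP (j \in T); last by rewrite !(mul0r, mulr0).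
  move: iT jT; rewrite !inE => /andP[iS /eqP li] /andP[jS /eqP lj].
  rewrite li lj mulr1 mul1r mulr1 mulr1; apply: ler_wpM2r => //; exact: AX.
apply: le_trans low.
have -> : \sum_i x i * (1 - ind (~: T) i) = \sum_i ind T i * x i.
  by apply: eq_bigr => i _; rewrite indC; ring.
set sg := \sum_i ind T i * x i in res *; set A := \sum_i _ in res *; set B := \sum_i _ in noise *.
have q0 : 0 <= rho' * n%:R by rewrite mulr_ge0 // ltW.
have Q0 : 0 <= d * K ^+ 2 * (rho' * n%:R) by rewrite mulr_ge0 // mulr_ge0 ?sqr_ge0 ?(ltW d0).
have rz : rho' / zeta <= 1 by rewrite ler_pdivrMr // mul1r.
have zq : K * d / (zeta * n%:R) * (th ^+ 2 * n%:R ^+ 2) <= d * K ^+ 2 * (rho' * n%:R).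
  have -> : K * d / (zeta * n%:R) * (th ^+ 2 * n%:R ^+ 2) =
      d * K ^+ 2 * (rho' * n%:R) * (rho' / zeta).
    by rewrite thsq; field; rewrite !gt_eqF.
  exact: ler_piMr.
have cq : K * d * (th * n%:R) <= d * K ^+ 2 * (rho' * n%:R).
  have -> : d * K ^+ 2 * (rho' * n%:R) = K * d * (K * rho' * n%:R) by ring.
  by rewrite ler_wpM2l ?(ltW Kd0) // ler_wpM2r // ltW.
have Rq : d * K / 2 * (gamma * n%:R + (n%:R - #|T|%:R)) <= d * K ^+ 2 * (rho' * n%:R).
  have -> : d * K ^+ 2 * (rho' * n%:R) = d * K / 2 * (2 * (K * rho' * n%:R)) by field.
  rewrite ler_wpM2l ?divr_ge0 ?(mulr_ge0 (ltW d0) (ltW K0)) //.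
  have : rho * n%:R <= K * rho' * n%:R by rewrite ler_wpM2r // ltW.
  by rewrite card_setC in cTn; lra.
have -> : 10 * d * K ^+ 2 * (K * sg - rho' * n%:R) =
  10 * d * K ^+ 3 * sg - 10 * (d * K ^+ 2 * (rho' * n%:R)) by ring.
lra.
Qed.

End Boosting.

(** * An optimal solution leaves few wrong coordinates unflipped *)

Section Decoding.
Context {R : realType} {n : nat}.
Implicit Types (Ahat X M N W : 'M[R]_n) (l ltil w x : 'I_n -> R) (S T U : {set 'I_n}).
Implicit Types (zeta d K gamma rho : R).

Lemma label_norm l : is_label l -> forall i, `|l i| = 1.
Proof. by move=> lab i; case: (lab i) => ->; rewrite ?normrN normr1. Qed.

Lemma label_neq l l' i : is_label l -> is_label l' -> l i != l' i -> l i = - l' i.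
Proof.
by move=> lab lab'; case: (lab i) (lab' i) => -> [] -> //; rewrite ?eqxx // opprK.
Qed.

Lemma sqrt_ge100 K : 10 ^+ 4 <= K -> 100 <= Num.sqrt K.
Proof.
move=> K4; have K0 : 0 <= K by lra.
by rewrite -(@ler_pXn2r _ 2) ?nnegrE ?sqrtr_ge0 // sqr_sqrtr //; lra.
Qed.

(* Test the SDP constraint on [M = 1_U 1_T^T]: the labels disagree with the truth on
   [U] and agree with it on [T], so the signal [F] has the wrong sign on [U x T], and only
   the noise can satisfy the constraint. *)
Lemma unflipped_bound Ahat X S ltil zeta d K gamma l rho w W N :
  boosting_data X S zeta d K gamma ->
  (forall i j, i \in S -> j \in S -> X i j <= Ahat i j * (ltil i * ltil j)) ->
  is_label ltil -> is_label l ->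
  sdp_feasible Ahat l zeta d K rho w W N ->
  let E := wrong S ltil l in
  rho <= gamma + #|E|%:R / n%:R -> gamma + #|E|%:R / n%:R <= zeta ->
  10 * #|[set i in E | w i < 1 - (Num.sqrt K)^-1]|%:R <= gamma * n%:R + #|E|%:R.
Proof.
move=> H AX labt lab feas E rho_le rho0_le; have g0 := gamma_ge0 H.
have [n0 zeta0 zeta1 d0 K4 gz Sge Xs _] := H.
have K0 : 0 < K by lra.
have s100 := sqrt_ge100 K4.
set U := [set i in E | _]; set u : R := #|U|%:R; set e : R := #|E|%:R in rho_le rho0_le *.
set T := correct S ltil l.
rewrite leNgt; apply/negP => big_u.
have UE : U \subset E by apply/fintype.subsetP => i; rewrite inE => /andP[].
have ES : E \subset S by exact: subsetDl.
have US : U \subset S := fintype.subset_trans UE ES.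
have TS : T \subset S by exact: subsetIl.
have ue : u <= e by rewrite ler_nat subset_leq_card.
have gn0 : 0 <= gamma * n%:R by rewrite mulr_ge0 // ltW.
have u0 : 0 < u by have : 0 <= e := ler0n _ _; lra.
have rn : (gamma + e / n%:R) * n%:R = gamma * n%:R + e by field; rewrite gt_eqF.
have gez : gamma * n%:R + e <= zeta * n%:R by rewrite -rn ler_wpM2r // ltW.
have [rho01 N_rect w01 sw [W0 WE con]] := feas.
have /andP[rho0 rhoz] := rho01.
have rhon : rho * n%:R <= 10 * u.
  by apply: le_trans (ltW big_u); rewrite -rn ler_wpM2r // ltW.
have TE := card_correct_wrong S ltil l; rewrite -/T -/E -/e in TE.
have K10 : 10 * u <= K * u by rewrite ler_wpM2r ?(ltW u0) //; lra.
have cT : #|~: T|%:R <= K * u by rewrite card_setC; lra.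
(* The mass of [1_U] is exactly [rho' n]. The assumption [big_u] gives [rho <= 10 rho'], which is
   within the range [rho <= K rho']. *)
pose rho' := u / n%:R.
have rho'n : rho' * n%:R = u by rewrite divfK // gt_eqF.
have rho'0 : 0 < rho' by rewrite divr_gt0.
have Krho'0 : 0 <= rho' * (K * rho') by apply/ltW/(mulr_gt0 rho'0)/mulr_gt0.
have rho'_range : rho / K <= rho' <= zeta.
  rewrite ler_pdivrMr // ler_pdivrMr //; apply/andP; split; last by lra.
  by rewrite -(ler_pM2r n0) mulrAC rho'n mulrC [u * K]mulrC; lra.
have indC i : ind (~: T) i = 1 - ind T i :> R.
  by rewrite /ind inE; case: (i \in T); rewrite ?subrr ?subr0.
have sel : rowsel rho' (K * rho') (\matrix_(i, j) (ind U i * ind T j)) (ind U).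
  split.
  - move=> i j; rewrite mxE; have /andP[? ?] := @ind_01 R _ U i; have /andP[? ?] := @ind_01 R _ T j.
    by rewrite mulr_ge0 //= mulr_ile1.
  - exact: ind_01.
  - by rewrite sum_ind rho'n.
  exists (\matrix_(i, j) (ind U i * ind (~: T) j)); split; last first.
    by apply/matrixP => i j; rewrite !mxE indC; ring.
  (* The missing columns number at most [K u], so the rectangle [U x ~: T] has mass at most
     [K u^2]. *)
  apply: ind_rect_pseudorect; first exact: sqrtr_ge0.
  rewrite exprMn sqr_sqrtr //.
  have -> : rho' * (K * rho') * n%:R ^+ 2 = u * (K * u) by rewrite -rho'n; ring.
  by rewrite ler_wpM2l // ltW.
have := con _ rho'_range _ _ sel; rewrite rho'n.
pose a i := ind U i * (1 - w i).
have a01 i : 0 <= a i <= 1.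
  have /andP[w0 w1] := w01 i; have /andP[U0 U1] := @ind_01 R _ U i.
  by rewrite /a mulr_ge0 ?subr_ge0 //= mulr_ile1 ?subr_ge0 //; lra.
have a1 i : `|a i| <= 1 by have /andP[? ?] := a01 i; rewrite ger0_norm.
have a_u : \sum_i `|a i| <= u.
  rewrite /u -sum_ind; apply: ler_sum => i _; have /andP[? _] := a01 i.
  have /andP[w0 w1] := w01 i; have /andP[U0 U1] := @ind_01 R _ U i.
  by rewrite ger0_norm // /a -[leRHS]mulr1 ler_wpM2l //; lra.
have Sa i : ind S i * a i = a i.
  rewrite /a /ind; have [/(fintype.subsetP US) ->|_] := boolP (i \in U); first by rewrite mul1r.
  by rewrite !mul0r mulr0.
have Ssum : \sum_i ind S i * a i = \sum_i a i by apply: eq_bigr => i _; exact: Sa.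
have aE : \sum_i `|a i| = \sum_i a i.
  by apply: eq_bigr => i _; have /andP[? _] := a01 i; rewrite ger0_norm.
(* An unflipped coordinate has [1 - w i] above [1 / sqrt K]. Hence [K] times the sum of [a] is at
   least [sqrt K u >= 100 u], and [99 u] remains after subtracting [u]. *)
have ua : u <= Num.sqrt K * \sum_i a i.
  rewrite /u -sum_ind mulr_sumr; apply: ler_sum => i _; rewrite /a /ind.
  have [iU|_] := boolP (i \in U); last by rewrite mul0r mulr0.
  move: iU; rewrite inE => /andP[_ wi].
  rewrite mul1r -ler_pdivrMl ?mulr1; lra.
have low : 10 * d * K ^+ 2 * (99 * u) <=
    10 * d * K ^+ 2 * (K * (\sum_i ind U i * (1 - w i)) - u).
  apply: ler_wpM2l; first by rewrite mulr_ge0 ?sqr_ge0 // mulr_ge0 // ltW.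
  have -> : K * (\sum_i ind U i * (1 - w i)) = Num.sqrt K * (Num.sqrt K * \sum_i a i).
    by rewrite mulrA -expr2 sqr_sqrtr // ltW.
  suff : 100 * u <= Num.sqrt K * (Num.sqrt K * \sum_i a i) by lra.
  by apply: ler_pM => //; apply: ltW.
move/(le_trans low) => {low}.
have Kd0 : 0 < K * d by rewrite mulr_gt0.
have z0 : 0 <= K * d / (zeta * n%:R) by rewrite divr_ge0 // ltW // mulr_gt0.
have Sge' : (1 - zeta) * n%:R <= #|S|%:R.
  by apply: le_trans Sge; rewrite ler_wpM2r ?(ltW n0) //; lra.
have uz : u <= zeta * n%:R by lra.
have res := resolvable_sum H (subxx S) Sge' a01.
rewrite Ssum -aE in res; have {}res := res (le_trans a_u uz).
have zu y : y <= zeta * n%:R -> K * d / (zeta * n%:R) * (u * y) <= K * d * u.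
  move=> yz; have -> : K * d / (zeta * n%:R) * (u * y) = K * d * u * (y / (zeta * n%:R)).
    by field; rewrite !gt_eqF.
  by rewrite ler_piMr ?mulr_ge0 ?(ltW K0) ?(ltW d0) ?(ltW u0) // ler_pdivrMr ?mulr_gt0 // mul1r.
have aS : supp a S by exact: supp_indM.
have noise1 := opsplit_bilin (ltW Kd0) z0 Xs aS (supp_ind ES) a1 (ind_norm E) a_u (sum_norm_ind E).
pose b j := ind T j * w j.
have b1 j : `|b j| <= 1.
  have /andP[w0 w1] := w01 j; have /andP[T0 T1] := @ind_01 R _ T j.
  by rewrite ger0_norm ?mulr_ge0 // mulr_ile1.
have b_sum : \sum_j `|b j| <= rho * n%:R.
  apply: le_trans sw; apply: ler_sum => j _.
  have /andP[w0 w1] := w01 j; have /andP[T0 T1] := @ind_01 R _ T j.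
  by rewrite ger0_norm ?mulr_ge0 // -[leRHS]mul1r ler_wpM2r.
have noise2 := opsplit_bilin (ltW Kd0) z0 Xs (supp_ind US) (supp_indM w TS) (ind_norm U) b1
  (sum_norm_ind U) b_sum.
have nU1 i : `|- ind U i| <= 1 :> R by rewrite normrN ind_norm.
have nUS : supp (fun i => - ind U i : R) S by move=> i iS; rewrite (supp_ind US iS) oppr0.
have noise3 := opsplit_trace (ltW Kd0) z0 Xs nUS (supp_ind TS) nU1 (ind_norm T) N_rect.
(* On [U x T] the signed [Ahat] is at most [-X]. Expanding [W] into [(1 - w_i) - w_j + N_ij], and
   [1_T] into [1_S - 1_E] in the first part, leaves one sum for resolvability on [S] and three for
   the noise bounds. *)
have up : frob (hadamard (hadamard Ahat (outer l)) W) (\matrix_(i, j) (ind U i * ind T j)) <=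
   - (\sum_i \sum_j ind S i * X i j * ind S j * a i)
   + \sum_i \sum_j a i * X i j * ind E j + \sum_i \sum_j ind U i * X i j * b j
   + \sum_i \sum_j - ind U i * X i j * ind T j * N i j.
  rewrite -sumrN -!big_split; apply: ler_sum => i _ /=.
  rewrite -sumrN -!big_split; apply: ler_sum => j _ /=.
  have STE : ind S j = ind T j + ind E j :> R.
    by rewrite /ind /T /E !inE; case: (j \in S); case: (_ == _); rewrite ?addr0 ?add0r.
  have -> : - (ind S i * X i j * ind S j * a i) + a i * X i j * ind E j +
      ind U i * X i j * b j + - ind U i * X i j * ind T j * N i j =
      - X i j * W i j * (ind U i * ind T j).
    have -> : ind S i * X i j * ind S j * a i = X i j * ind S j * a i.
      by rewrite -[in RHS](Sa i); ring.
    by rewrite STE WE /a /b; ring.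
  rewrite !mxE /ind.
  have [iU|_] := boolP (i \in U); last by rewrite !(mul0r, mulr0).
  have [jT|_] := boolP (j \in T); last by rewrite !(mul0r, mulr0).
  have iS := fintype.subsetP US _ iU; have jS := fintype.subsetP TS _ jT.
  move: iU jT; rewrite !inE => /andP[/andP[li _] _] /andP[_ /eqP lj].
  rewrite (label_neq lab labt li) lj !mulr1; apply: ler_wpM2r => //.
  by have := AX i j iS jS; lra.
move/le_trans => /(_ _ up) {up}.
move: res noise1 noise2 noise3; rewrite -/u -/e.
set A0 := \sum_i \sum_j ind S i * _ * _ * _; set A1 := \sum_i \sum_j a i * _ * _.
set A2 := \sum_i \sum_j _; set A3 := \sum_i \sum_j _.
move=> res noise1 noise2 noise3 fin.
have sa0 : 0 <= \sum_i `|a i| by exact: sumr_ge0.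
have zu1 := zu e; have zu2 := zu (rho * n%:R).
have z3 : K * d / (zeta * n%:R) * (rho ^+ 2 * n%:R ^+ 2) <= K * d * (rho * n%:R).
  have -> : K * d / (zeta * n%:R) * (rho ^+ 2 * n%:R ^+ 2) =
      K * d * (rho * n%:R) * (rho / zeta) by field; rewrite !gt_eqF.
  have rz : rho / zeta <= 1 by rewrite ler_pdivrMr // mul1r.
  by apply: ler_piMr => //; rewrite mulr_ge0 ?(ltW Kd0) // mulr_ge0 // ltW.
have Z1 : K * d / (zeta * n%:R) * (u * e) <= K * d * u by apply: zu; lra.
have Z2 : K * d / (zeta * n%:R) * (u * (rho * n%:R)) <= K * d * u.
  by apply: zu; rewrite ler_wpM2r // ltW.
have cr : K * d * (rho * n%:R) <= K * d * (10 * u) by rewrite ler_wpM2l // ltW.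
have ce : K * d * e <= K * d * (10 * u) by rewrite ler_wpM2l ?(ltW Kd0) //; lra.
have R0 : 0 <= 10 * d * K ^+ 3 * \sum_i `|a i|.
  by rewrite mulr_ge0 // mulr_ge0 ?exprn_ge0 ?(ltW K0) // mulr_ge0 // ltW.
have R1 : d * K / 2 * (gamma * n%:R + (n%:R - #|S|%:R)) <= d * K / 2 * (20 * u).
  by rewrite ler_wpM2l ?divr_ge0 ?(ltW K0) ?mulr_ge0 ?(ltW d0) ?(ltW K0) //; lra.
(* The four terms contribute at most [10], [6.5], [6.5] and [20] times [K d u], far below the
   required [990 K] times [K d u]. *)
have F1 : 10 * d * K ^+ 2 * (99 * u) = 990 * K * (K * d * u) by ring.
have F2 : 990 * 10 ^+ 4 * (K * d * u) <= 990 * K * (K * d * u).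
  by rewrite ler_wpM2r ?(mulr_ge0 (ltW Kd0) (ltW u0)) //; lra.
have F3 : 0 < K * d * u by rewrite mulr_gt0.
lra.
Qed.

End Decoding.

(** * Geometric decay of the number of wrong coordinates *)

Section Iteration.
Context {R : realType} {n : nat}.
Implicit Types (Ahat X N W : 'M[R]_n) (l ltil w : 'I_n -> R) (S : {set 'I_n}).
Implicit Types (zeta d K gamma rho : R).

Lemma flip_label K l w : is_label l -> is_label (flip K l w).
Proof.
by move=> lab i; rewrite /flip; case: ifP => _ //; case: (lab i) => ->; rewrite ?opprK; [right|left].
Qed.

(** The new errors lie in [U], wrong and not flipped, or in [V], correct but flipped. On [V] and on
    [E] minus [U] the weight [w] is at least [99/100], so its total, at most [gamma n + |E|], is
    nearly used up by [E] minus [U], leaving little for [V]. *)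
Lemma flip_step Ahat X S ltil zeta d K gamma l rho w W N :
  boosting_data X S zeta d K gamma ->
  (forall i j, i \in S -> j \in S -> X i j <= Ahat i j * (ltil i * ltil j)) ->
  is_label ltil -> is_label l ->
  gamma + #|wrong S ltil l|%:R / n%:R <= zeta ->
  sdp_optimal Ahat l zeta d K rho w W N ->
  #|wrong S ltil (flip K l w)|%:R <= 5 / 4 * (gamma * n%:R) + #|wrong S ltil l|%:R / 4.
Proof.
move=> H AX labt lab rhoz [feas opt]; have g0 := gamma_ge0 H.
have rho_le := opt _ _ _ _ (sdp_feasible_truth H AX rhoz).
have U_le := unflipped_bound H AX labt lab feas rho_le rhoz.
have n0 := n_gt0 H; have s100 := sqrt_ge100 (K_ge H).
have gn0 : 0 <= gamma * n%:R by rewrite mulr_ge0 // ltW.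
have [_ _ w01 sw _] := feas.
move: U_le; set thr := 1 - _; set E := wrong S ltil l in rho_le rhoz *.
set U := [set i in E | _] => U_le.
have thr99 : 99 / 100 <= thr.
  have : (Num.sqrt K)^-1 <= 100^-1 by rewrite lef_pV2 ?posrE //; lra.
  by rewrite /thr; lra.
pose V := [set i in correct S ltil l | thr <= w i].
have UE : U \subset E by apply/fintype.subsetP => i; rewrite inE => /andP[].
have cEU : #|E :\: U|%:R = #|E|%:R - #|U|%:R :> R.
  by rewrite -(cardsID U E) natrD (finset.setIidPr UE) addrAC subrr add0r.
have wsum : thr * (#|V|%:R + (#|E|%:R - #|U|%:R)) <= gamma * n%:R + #|E|%:R.
  have rn : (gamma + #|E|%:R / n%:R) * n%:R = gamma * n%:R + #|E|%:R.
    by field; rewrite gt_eqF.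
  rewrite -rn; apply: le_trans (_ : rho * n%:R <= _); last by rewrite ler_wpM2r // ltW.
  apply: le_trans sw; rewrite -cEU -!sum_ind -big_split mulr_sumr /=.
  apply: ler_sum => i _; have /andP[w0 _] := w01 i.
  rewrite /ind !inE ltNge.
  by case: (i \in S); case: (l i == ltil i); case: (leP thr (w i)) => /= ?; lra.
have wUV : wrong S ltil (flip K l w) \subset U :|: V.
  apply/fintype.subsetP => i; rewrite !inE /flip -/thr => /andP[nl iS].
  rewrite iS /= andbT; case: (leP thr (w i)) nl => // _ nl; last by rewrite nl.
  rewrite andbF andbT /=; apply: contraNT nl => nl.
  by rewrite (label_neq lab labt nl) opprK.
have : #|wrong S ltil (flip K l w)|%:R <= #|U|%:R + #|V|%:R :> R.
  by rewrite -natrD ler_nat (leq_trans (subset_leq_card wUV)) // cardsU leq_subr.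
have V0 : 0 <= #|V|%:R + (#|E|%:R - #|U|%:R) :> R.
  by rewrite -cEU -natrD ler0n.
have := ler_wpM2r V0 thr99.
lra.
Qed.

(** The recursion [e -> 5/4 gamma n + e/4] contracts by 4 towards its fixed point [5/3 gamma n]. *)
Lemma wrong_decay Ahat X S ltil zeta d K gamma (T : nat) (ls : nat -> 'I_n -> R) :
  boosting_data X S zeta d K gamma ->
  (forall i j, i \in S -> j \in S -> X i j <= Ahat i j * (ltil i * ltil j)) ->
  is_label ltil -> is_label (ls 0%N) ->
  #|wrong S ltil (ls 0%N)|%:R <= zeta / 10 * n%:R ->
  boosting_run Ahat zeta d K (ls 0%N) T ls ->
  #|wrong S ltil (ls T)|%:R <= 5 / 3 * (gamma * n%:R) + zeta / 10 * n%:R / 4 ^+ T.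
Proof.
move=> H AX labt lab0 e0 [_ run]; have g0 := gamma_ge0 H.
have n0 := n_gt0 H; have z0 := zeta_gt0 H; have gz := gamma_le H.
have gn0 : 0 <= gamma * n%:R by rewrite mulr_ge0 // ltW.
suff /(_ T (leqnn T)) [] : forall t, (t <= T)%N -> is_label (ls t) /\
  #|wrong S ltil (ls t)|%:R <= 5 / 3 * (gamma * n%:R) + zeta / 10 * n%:R / 4 ^+ t by [].
elim=> [_|t IHt tT]; first by split=> //; rewrite expr0 divr1; lra.
have [lab et] := IHt (ltnW tT).
have [rho [w [W [N [opt ->]]]]] := run _ tT.
split; first exact: flip_label.
have zn0 : 0 <= zeta / 10 * n%:R by rewrite mulr_ge0 ?divr_ge0 ?ltW.
have pow_le : zeta / 10 * n%:R / 4 ^+ t <= zeta / 10 * n%:R.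
  by rewrite ler_pdivrMr ?exprn_gt0 // ler_peMr // exprn_ege1 // ler1n.
have gzn : gamma * n%:R <= zeta / 10 * n%:R by rewrite ler_wpM2r // ltW.
have zn : 0 < zeta * n%:R by rewrite mulr_gt0.
(* The invariant keeps the next round applicable: the total is at most [(1 + 5/3 + 1) zeta / 10]. *)
have rhoz : gamma + #|wrong S ltil (ls t)|%:R / n%:R <= zeta.
  rewrite -(ler_pM2r n0) mulrDl divfK ?gt_eqF //; lra.
apply: le_trans (flip_step H AX labt lab rhoz opt) _.
have -> : zeta / 10 * n%:R / 4 ^+ t.+1 = zeta / 10 * n%:R / 4 ^+ t / 4.
  by rewrite exprSr invfM mulrA.
lra.
Qed.

End Iteration.

(** * The number of rounds and the final count of errors *)

Lemma leq_exp_ceil_ln (R : realType) (n T : nat) : (0 < n)%N ->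
  (T : int) = Num.ceil (10 * ln (n%:R : R)) -> n%:R <= 4 ^+ T :> R.
Proof.
move=> n0 TE; have n0R : 0 < n%:R :> R by rewrite ltr0n.
have lnT : ln (n%:R : R) <= 10^-1 * T%:R.
  have : 10 * ln (n%:R : R) <= T%:R.
    by have := @ceil_ge R (10 * ln n%:R); rewrite -TE.
  by lra.
(* From [exp(-1/10) >= 9/10]. *)
have e10 : expR (10^-1 : R) <= 4.
  have := expR_ge1Dx (- 10^-1 : R); rewrite expRN.
  have e0 := expR_gt0 (10^-1 : R) => h.
  have := ler_wpM2r (ltW e0) h; rewrite mulVf ?gt_eqF //; lra.
rewrite -[n%:R]lnK ?posrE //; apply: (@le_trans _ _ (expR (10^-1 * T%:R))).
  by rewrite ler_expR.
by rewrite expRM_natr lerXn2r ?nnegrE ?expR_ge0.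
Qed.

Unset Implicit Arguments.
Set Strict Implicit.

Theorem mainTheorem14 (R : realType) (n : nat) (Ahat : 'M[R]_n)
  (zeta d K gamma : R) (linit ltil : 'I_n -> R) (S : {set 'I_n}) (F : 'M[R]_n) :
  0 < zeta < 1 -> 0 < d -> 10 ^+ 4 <= K ->
  is_label linit -> is_label ltil ->
  (1 - gamma) * n%:R <= #|S|%:R ->
  gamma <= zeta / 10 ->
  (* (1) *)
  (1 - zeta / 10) * n%:R <= (agree linit ltil)%:R ->
  (* (2) *)
  (forall i j, i \in S -> j \in S -> 0 <= hadamard F (outer ltil) i j) ->
  (* (3) *)
  (exists Y Z : 'M[R]_#|S|,
     [/\ subm S S (Ahat - F) = Y + Z,
         opnorm_le Y (K * d)
       & forall i j, `|Z i j| <= K * d / (zeta * n%:R)]) ->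
  (* (4) *)
  (forall T : {set 'I_n}, T \subset S -> (1 - zeta) * n%:R <= #|T|%:R ->
     resolvable (subm T T (hadamard (Ahat - F) (outer ltil)))
       (10 * d * K ^+ 3)
       (1 / 2 * d * K * (gamma + (n%:R - #|T|%:R) / n%:R))) ->
  (* conclusion: every execution of Boosting Using SDP, with ceil(10 log n) rounds *)
  forall (Titer : nat) (ls : nat -> 'I_n -> R),
    (Titer : int) = Num.ceil (10 * ln (n%:R : R)) ->
    boosting_run Ahat zeta d K linit Titer ls ->
    (1 - 8 * gamma) * n%:R <= (agree (ls Titer) ltil)%:R.
Proof.
move=> /andP[zeta0 zeta1] d0 K4 labi labt Sge gz init FS XS Xres Titer ls TE run.
(* The estimates divide by [n]; for [n = 0] the claim is trivial. *)
have [n_eq0|n_gt0] := posnP n; first by subst n; rewrite mulr0 ler0n.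
have n0 : 0 < n%:R :> R by rewrite ltr0n.
have K0 : 0 < K by lra.
have Kd0 : 0 < K * d by rewrite mulr_gt0.
have z0 : 0 <= K * d / (zeta * n%:R) by rewrite divr_ge0 // ltW // mulr_gt0.
pose X := hadamard (Ahat - F) (outer ltil).
have H : boosting_data X S zeta d K gamma.
  by split=> //; exact: opsplit_sign (ltW Kd0) (label_norm labt) (opsplit_sub Kd0 z0 XS).
have AX i j : i \in S -> j \in S -> X i j <= Ahat i j * (ltil i * ltil j).
  by move=> iS jS; have := FS i j iS jS; rewrite !mxE; lra.
have agreeE l : (agree l ltil)%:R = n%:R - #|~: [set i | l i == ltil i]|%:R :> R.
  by rewrite card_setC opprB addrC subrK.
have ls0 : ls 0%N = linit by case: run.
have e0 : #|wrong S ltil (ls 0%N)|%:R <= zeta / 10 * n%:R.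
  rewrite ls0; apply: (@le_trans _ _ #|~: [set i | linit i == ltil i]|%:R).
    by rewrite ler_nat subset_leq_card // /wrong finset.setDE finset.subsetIr.
  by move: init; rewrite agreeE; lra.
rewrite -ls0 in run labi.
have := wrong_decay H AX labt labi e0 run.
set e := #|wrong _ _ _|; move=> e_le.
have tail : zeta / 10 * n%:R / 4 ^+ Titer <= 1 / 10.
  have n4 := leq_exp_ceil_ln n_gt0 TE.
  rewrite ler_pdivrMr ?exprn_gt0 //.
  apply: le_trans (_ : zeta / 10 * 4 ^+ Titer <= _).
    by rewrite ler_wpM2l // divr_ge0 // ltW.
  by rewrite ler_wpM2r ?exprn_ge0 //; lra.
(* Every coordinate outside [S] is counted as an error. *)
have D_le : (#|~: [set i | ls Titer i == ltil i]| <= #|~: S| + e)%N.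
  rewrite -(cardsID S (~: [set i | ls Titer i == ltil i])) addnC leq_add // subset_leq_card //; apply/fintype.subsetP => i.
    by rewrite !inE => /andP[].
  by rewrite !inE andbC.
rewrite agreeE; move: D_le; set D := #|_| => D_le.
have D_leR : D%:R <= #|~: S|%:R + e%:R :> R by rewrite -natrD ler_nat.
rewrite card_setC in D_leR.
have g0 := gamma_ge0 H.
have gn0 : 0 <= gamma * n%:R by rewrite mulr_ge0 // ltW.
(* The bound on the number [D] of errors is 8/3 gamma n + 1/10, and [D] is an integer. *)
suff : D%:R <= 8 * gamma * n%:R by lra.
case: D D_leR {D_le} => [|m] D_leR; first by rewrite -mulrA mulr_ge0.
have : 1 <= m.+1%:R :> R by rewrite ler1n.
lra.
Qed.
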